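(* Let $X$ be a (nonempty) simply connected length space, and let $D=d_{\mathrm{GH}}\left(X,(\mathbb{S}^1,d_{\mathbb{R}^2})\right)$. Then it is not the case that $D\leq 1$ and $D+\sqrt{2-2\sqrt{1-D^2}}<1$.
   Context: $(\mathbb{S}^1,d_{\mathbb{R}^2})$ denotes the unit circle $\{z\in\mathbb{R}^2:\|z\|=1\}$ with the Euclidean metric inherited from $\mathbb{R}^2$ (not the intrinsic metric). For a metric space $(Z,d_Z)$ and nonempty $A,B\subseteq Z$, let $d_Z(z,A)=\inf_{a\in A}d_Z(z,a)$ and let the Hausdorff distance be $d_{\mathrm{H}}^Z(A,B)=\max\left(\sup_{a\in A}d_Z(a,B),\sup_{b\in B}d_Z(b,A)\right)$. The Gromov-Hausdorff distance between nonempty metric spaces $X,Y$ is the value in $[0,\infty]$ given by $d_{\mathrm{GH}}(X,Y)=\inf d_{\mathrm{H}}^Z(X',Y')$, the infimum being over all metric spaces $Z$ and subspaces $X',Y'\subseteq Z$ with $X'$ isometric to $X$ and $Y'$ isometric to $Y$. A metric space $(X,d_X)$ is a length space if for all $x,x'\in X$ the distance $d_X(x,x')$ is the infimum of the lengths of paths $\gamma:[0,1]\to X$ from $x$ to $x'$. *)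

(* Defs.v *)
From HB Require Import structures.
From mathcomp Require Import all_boot all_order all_algebra.
From mathcomp Require Import ring lra.
From mathcomp Require Import all_classical all_reals all_analysis.

Set Implicit Arguments.
Unset Strict Implicit.
Unset Printing Implicit Defensive.

Import Order.TTheory GRing.Theory Num.Theory.
Import numFieldNormedType.Exports.

Local Open Scope classical_set_scope.
Local Open Scope ring_scope.

(* The norm the library puts on R * R is the sup norm, hence a separate
   Euclidean norm. *)
Definition euclid_norm (R : realType) (z : R * R) : R :=
  Num.sqrt (z.1 ^+ 2 + z.2 ^+ 2).

Lemma euclid_normN (R : realType) (z : R * R) :
  euclid_norm (- z) = euclid_norm z.
Proof. by rewrite /euclid_norm /= !sqrrN. Qed.

Lemma euclid_norm0 (R : realType) : euclid_norm (0 : R * R) = 0.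
Proof. by rewrite /euclid_norm /= expr0n /= addr0 sqrtr0. Qed.

Lemma euclid_norm_eq0 (R : realType) (z : R * R) :
  euclid_norm z = 0 -> z = 0.
Proof.
case: z => a b /eqP; rewrite /euclid_norm sqrtr_eq0 /= => ab.
have a2 := sqr_ge0 a; have b2 := sqr_ge0 b.
have /eqP : a ^+ 2 = 0 by lra.
have /eqP : b ^+ 2 = 0 by lra.
by rewrite !sqrf_eq0 => /eqP -> /eqP ->.
Qed.

Lemma euclid_normD (R : realType) (z w : R * R) :
  euclid_norm (z + w) <= euclid_norm z + euclid_norm w.
Proof.
case: z w => [a b] [c d]; rewrite /euclid_norm /=.
set p := a ^+ 2 + b ^+ 2; set q := c ^+ 2 + d ^+ 2.
have p0 : 0 <= p by rewrite addr_ge0 ?sqr_ge0.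
have q0 : 0 <= q by rewrite addr_ge0 ?sqr_ge0.
have s0 : 0 <= Num.sqrt p + Num.sqrt q by rewrite addr_ge0 ?sqrtr_ge0.
rewrite -[leRHS](ger0_norm s0) -sqrtr_sqr ler_wsqrtr//.
rewrite [leRHS]sqrrD !sqr_sqrtr// -sqrtrM//.
have : a * c + b * d <= Num.sqrt (p * q).
  rewrite (le_trans (ler_norm _))// -sqrtr_sqr ler_wsqrtr// -subr_ge0.
  have -> : p * q - (a * c + b * d) ^+ 2 = (a * d - b * c) ^+ 2.
    by rewrite /p /q; ring.
  exact: sqr_ge0.
rewrite mulr2n /p /q; lra.
Qed.

Record circle (R : realType) := Circle {
  circle_val : R * R ;
  circle_valP : euclid_norm circle_val == 1 }.

HB.instance Definition _ (R : realType) := [isSub for @circle_val R].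
HB.instance Definition _ (R : realType) := [Choice of circle R by <:].

Definition circle_dist (R : realType) (z w : circle R) : R :=
  euclid_norm (circle_val z - circle_val w).

Lemma circle_distxx (R : realType) (z : circle R) : circle_dist z z = 0.
Proof. by rewrite /circle_dist subrr euclid_norm0. Qed.

Lemma circle_dist_positivity (R : realType) (z w : circle R) :
  circle_dist z w = 0 -> z = w.
Proof. by move/euclid_norm_eq0/eqP; rewrite subr_eq0 => /eqP/val_inj. Qed.

Lemma circle_dist_sym (R : realType) (z w : circle R) :
  circle_dist z w = circle_dist w z.
Proof. by rewrite /circle_dist -opprB euclid_normN. Qed.

Lemma circle_dist_triangle (R : realType) (y x z : circle R) :
  circle_dist x z <= circle_dist x y + circle_dist y z.
Proof.
rewrite /circle_dist.
rewrite -[X in euclid_norm X](subrKA (circle_val y)).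
exact: euclid_normD.
Qed.

HB.instance Definition _ (R : realType) := @isMetric.Build R (circle R)
  (@circle_dist R) (@circle_distxx R) (@circle_dist_positivity R)
  (@circle_dist_sym R) (@circle_dist_triangle R).

Definition dist_to_set (R : realType) (Z : metricType R) (z : Z) (A : set Z)
    : \bar R :=
  ereal_inf [set (mdist z a)%:E | a in A].

Definition hausdorff_dist (R : realType) (Z : metricType R) (A B : set Z)
    : \bar R :=
  maxe (ereal_sup [set dist_to_set a B | a in A])
       (ereal_sup [set dist_to_set b A | b in B]).

Definition isometric_to_subset (R : realType) (X Z : metricType R)
    (A : set Z) : Prop :=
  exists2 f : X -> Z,
    (forall x y : X, mdist (f x) (f y) = mdist x y) & f @` [set: X] = A.

Definition gromov_hausdorff_dist (R : realType) (X Y : metricType R)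
    : \bar R :=
  ereal_inf [set r | exists (Z : metricType R) (X' Y' : set Z),
    [/\ isometric_to_subset X X', isometric_to_subset Y Y' &
        r = hausdorff_dist X' Y']].

(* Paths [0, 1] -> X are represented by functions on R, whose values outside
   [0, 1] are irrelevant. *)
Definition is_path (R : realType) (X : topologicalType) (x y : X)
    (g : R -> X) : Prop :=
  [/\ {within `[0, 1], continuous g}, g 0 = x & g 1 = y].

(* The analogue of [total_variation 0 1], which is restricted to real-valued
   functions. An [itv_partition 0 1 s] does not list the left endpoint 0. *)
Definition path_length (R : realType) (X : metricType R) (g : R -> X)
    : \bar R :=
  ereal_sup [set (\sum_(0 <= i < size s)
                    mdist (g (nth 0 (0 :: s) i)) (g (nth 0 (0 :: s) i.+1)))%:E
            | s in [set s | itv_partition 0 1 s]].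

Definition length_space (R : realType) (X : metricType R) : Prop :=
  forall x y : X,
    (mdist x y)%:E = ereal_inf [set path_length g | g in is_path x y].

Definition path_homotopic (R : realType) (X : topologicalType) (x y : X)
    (g h : R -> X) : Prop :=
  exists H : R * R -> X,
    [/\ {within `[0, 1] `*` `[0, 1], continuous H},
        {in `[0, 1], forall t, H (t, 0) = g t},
        {in `[0, 1], forall t, H (t, 1) = h t},
        {in `[0, 1], forall s, H (0, s) = x} &
        {in `[0, 1], forall s, H (1, s) = y}].

Definition simply_connected (R : realType) (X : topologicalType) : Prop :=
  (forall x y : X, exists g : R -> X, is_path x y g) /\
  (forall (x : X) (g : R -> X),
     is_path x x g -> path_homotopic x x g (cst x)).

(* Main.v *)
Require Import Defs.
From mathcomp Require Import all_boot all_order all_algebra.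
From mathcomp Require Import all_classical all_reals all_analysis.
From mathcomp Require Import ring lra zify.

Import Order.TTheory GRing.Theory Num.Theory.
Import numFieldNormedType.Exports.
Local Open Scope classical_set_scope.
Local Open Scope ring_scope.

Set Implicit Arguments.
Unset Strict Implicit.
Unset Printing Implicit Defensive.

(** The chord of the arc of sine [D] has length [sqrt (2 - 2 sqrt (1 - D^2))],
    which is at least [D]; so the two inequalities to be refuted force
    [D < 1/2].  The proof shows more: a simply connected length space [X] is at
    Gromov-Hausdorff distance at least [1 / sqrt 3] from the Euclidean circle
    ([gromov_hausdorff_circle_ge]), and [1/2 < 1 / sqrt 3].

    Suppose the distance is below [r] with [3 r < sqrt 3].  Inside a common
    metric space, choose for each point [x] of [X] a point [F x] of the circle
    within [r] of it, and for each [u] on the circle a point [G u] of [X] within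
    [r] of it.  [F] is not continuous, but it moves points that are close
    together in [X] by little more than [2 r < sqrt 3], which is enough to speak
    of winding numbers.  Three points of the circle whose pairwise distances are
    below [sqrt 3] span a triangle that misses the origin, so the signed number
    of crossings of a fixed ray adds up along such triangles
    ([crossing_cocycle]).  Hence the image under [F] of a path in [X] has a
    number of crossings that can be computed on any fine subdivision
    ([has_winding]).  This number vanishes on null-homotopic loops: cut the
    square of the homotopy into a fine grid and compare consecutive rows
    ([null_homotopic_winding]).

    On the other hand, let [u_0, ..., u_k = u_0] be a fine regular polygon on
    the circle.  The points [G u_i] and [G u_(i+1)] are at distance little more
    than [2 r], so, [X] being a length space, a path between them stays within
    little more than [r] of one of its ends.  [F] then maps it to points at
    distance less than [sqrt 3] from [u_i] or [u_(i+1)], so that its crossings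
    are those of the edge from [u_i] to [u_(i+1)], up to a correction that
    telescopes ([has_winding_link]).  The concatenation of these paths is a loop
    in [X] with as many crossings as the polygon, namely one
    ([polygon_crossings]); but loops in [X] are null-homotopic. *)

(** * Crossings of a ray by chords of the circle *)

Definition dot (R : realType) (u v : R * R) : R := u.1 * v.1 + u.2 * v.2.
Definition cross (R : realType) (u v : R * R) : R := u.1 * v.2 - u.2 * v.1.

Lemma circle_dot_self (R : realType) (u : circle R) :
  dot (circle_val u) (circle_val u) = 1.
Proof.
case: u => -[a b] /= /eqP; rewrite /euclid_norm /dot /= => h.
by rewrite -!expr2 -[LHS]sqr_sqrtr ?addr_ge0 ?sqr_ge0 // h expr1n.
Qed.

Lemma circle_dist_sqr (R : realType) (u v : circle R) :
  mdist u v ^+ 2 = 2 - 2 * dot (circle_val u) (circle_val v).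
Proof.
have := circle_dot_self u; have := circle_dot_self v.
rewrite [mdist _ _]/(circle_dist u v) /circle_dist /euclid_norm.
rewrite sqr_sqrtr ?addr_ge0 ?sqr_ge0 //.
case: u v => -[a b] /= _ [[c d] /= _]; rewrite /dot /= => h1 h2.
lra.
Qed.

(** [sqrt 3] is the side of the inscribed equilateral triangle: below it, three
    points are confined to an open half-circle. *)
Definition chord_close (R : realType) (u v : circle R) : Prop :=
  mdist u v < Num.sqrt 3.

Lemma chord_closeE (R : realType) (u v : circle R) :
  chord_close u v <-> - 2^-1 < dot (circle_val u) (circle_val v).
Proof.
rewrite /chord_close -(ltr_pXn2r (n := 2)) ?nnegrE ?sqrtr_ge0 ?mdist_ge0 //.
by rewrite circle_dist_sqr sqr_sqrtr //; split; lra.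
Qed.

(** The pairwise inner products exceed [-1/2], so the squared norm of a
    combination with nonnegative weights [p], [q], [r] exceeds
    [p^2 + q^2 + r^2 - p q - q r - p r >= 0] when two weights are positive, and
    is the square of the positive weight when there is only one. *)
Lemma chord_close_no_hull (R : realType) (u v w : circle R) (p q r : R) :
  chord_close u v -> chord_close v w -> chord_close u w ->
  0 <= p -> 0 <= q -> 0 <= r -> 0 < p + q + r ->
  ~ (p * (circle_val u).1 + q * (circle_val v).1 + r * (circle_val w).1 = 0 /\
     p * (circle_val u).2 + q * (circle_val v).2 + r * (circle_val w).2 = 0).
Proof.
move=> /chord_closeE uv /chord_closeE vw /chord_closeE uw p0 q0 r0 s0.
have := circle_dot_self u; have := circle_dot_self v; have := circle_dot_self w.
move: uv vw uw; rewrite /dot.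
case: (circle_val u) (circle_val v) (circle_val w) => [a b] [c d] [e f] /=.
move=> uv vw uw w1 v1 u1 [E1 E2].
have : (p * a + q * c + r * e) ^+ 2 + (p * b + q * d + r * f) ^+ 2 = 0.
  by rewrite E1 E2; ring.
have -> : (p * a + q * c + r * e) ^+ 2 + (p * b + q * d + r * f) ^+ 2 =
 p ^+ 2 + q ^+ 2 + r ^+ 2 + 2 * (p * q * (a * c + b * d))
 + 2 * (q * r * (c * e + d * f)) + 2 * (p * r * (a * e + b * f)).
  have -> : p ^+ 2 + q ^+ 2 + r ^+ 2 = p ^+ 2 * (a * a + b * b) +
      q ^+ 2 * (c * c + d * d) + r ^+ 2 * (e * e + f * f).
    by rewrite u1 v1 w1 !mulr1.
  by ring.
have pq : - (p * q) / 2 <= p * q * (a * c + b * d).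
  have := mulr_ge0 p0 q0; nra.
have qr : - (q * r) / 2 <= q * r * (c * e + d * f).
  have := mulr_ge0 q0 r0; nra.
have pr : - (p * r) / 2 <= p * r * (a * e + b * f).
  have := mulr_ge0 p0 r0; nra.
have [pq0|pq0] := ltP 0 (p * q).
  have : - (p * q) / 2 < p * q * (a * c + b * d) by nra.
  have := sqr_ge0 (p - q); have := sqr_ge0 (q - r); have := sqr_ge0 (p - r); nra.
have [qr0|qr0] := ltP 0 (q * r).
  have : - (q * r) / 2 < q * r * (c * e + d * f) by nra.
  have := sqr_ge0 (p - q); have := sqr_ge0 (q - r); have := sqr_ge0 (p - r); nra.
have [pr0|pr0] := ltP 0 (p * r).
  have : - (p * r) / 2 < p * r * (a * e + b * f) by nra.
  have := sqr_ge0 (p - q); have := sqr_ge0 (q - r); have := sqr_ge0 (p - r); nra.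
have := exprn_gt0 2 s0; nra.
Qed.

Lemma cross_opp (R : realType) (u v : R * R) : cross v u = - cross u v.
Proof. by rewrite /cross; ring. Qed.

Lemma chord_close_sym (R : realType) (u v : circle R) :
  chord_close u v -> chord_close v u.
Proof. by rewrite /chord_close metric_sym. Qed.

(** The three cross products are the weights of a linear relation between three
    plane vectors; were they all nonnegative, the origin would lie in the
    triangle. *)
Lemma chord_close_turn (R : realType) (u v w : circle R) :
  chord_close u v -> chord_close v w -> chord_close u w ->
  0 < cross (circle_val u) (circle_val v) ->
  0 <= cross (circle_val w) (circle_val u) ->
  cross (circle_val v) (circle_val w) < 0.
Proof.
move=> uv vw uw cuv cwu; rewrite ltNge; apply/negP => cvw.
apply: (chord_close_no_hull uv vw uw cvw cwu (ltW cuv)); first lra.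
by rewrite /cross; split; ring.
Qed.

Definition upcrosses (R : realType) (u v : R * R) : bool :=
  (u.2 < 0 <= v.2) && (0 < cross u v).

(** Intersection number of the oriented chord from [u] to [v] with the ray of
    positive abscissas, counted positively when the chord goes upwards. *)
Definition crossing (R : realType) (u v : circle R) : int :=
  (upcrosses (circle_val u) (circle_val v))%:Z -
  (upcrosses (circle_val v) (circle_val u))%:Z.

Lemma crossing_sym (R : realType) (u v : circle R) :
  crossing v u = - crossing u v.
Proof. by rewrite /crossing opprB. Qed.

Lemma crossing_refl (R : realType) (u : circle R) : crossing u u = 0.
Proof. by rewrite /crossing subrr. Qed.

Lemma crossing_same_side (R : realType) (u v : circle R) :
  ((circle_val u).2 < 0) = ((circle_val v).2 < 0) -> crossing u v = 0.
Proof. by rewrite /crossing /upcrosses !leNgt => ->; case: (_ < 0). Qed.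

(** Two chords from a point below the axis to points above it pass on the same
    side of the origin, since otherwise the triangle would contain it. *)
Lemma cross_gt0_same_above (R : realType) (u v w : circle R) :
  chord_close u v -> chord_close v w -> chord_close u w ->
  (circle_val u).2 < 0 -> 0 <= (circle_val v).2 -> 0 <= (circle_val w).2 ->
  0 < cross (circle_val u) (circle_val v) ->
  0 < cross (circle_val u) (circle_val w).
Proof.
move=> uv vw uw yu yv yw cuv; rewrite ltNge; apply/negP => cuw.
have cwu : 0 <= cross (circle_val w) (circle_val u).
  by rewrite cross_opp oppr_ge0.
have := chord_close_turn uv vw uw cuv cwu.
move: yu yv yw cuv cwu; clear; rewrite /cross.
case: (circle_val u) (circle_val v) (circle_val w) => [a b] [c d] [e f] /=.
move=> yu yv yw cuv cwu cvw.
have h1 : 0 < (c * f - d * e) * b by rewrite nmulr_lgt0.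
have h2 := mulr_ge0 cwu yv; have h3 := mulr_ge0 (ltW cuv) yw.
lra.
Qed.

Lemma cross_gt0_same_below (R : realType) (u v w : circle R) :
  chord_close u v -> chord_close v w -> chord_close u w ->
  0 <= (circle_val u).2 -> (circle_val v).2 < 0 -> (circle_val w).2 < 0 ->
  0 < cross (circle_val v) (circle_val u) ->
  0 < cross (circle_val w) (circle_val u).
Proof.
move=> uv vw uw yu yv yw cvu; rewrite ltNge; apply/negP => cwu.
have cvw : 0 < cross (circle_val v) (circle_val w).
  rewrite ltNge; apply/negP => cvw.
  have := chord_close_turn (chord_close_sym uv) uw vw cvu.
  rewrite (cross_opp (circle_val v)) (cross_opp (circle_val w) (circle_val u)).
  by rewrite oppr_ge0 oppr_lt0 => /(_ cvw); rewrite ltNge cwu.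
move: yu yv yw cvu cwu cvw; clear; rewrite /cross.
case: (circle_val u) (circle_val v) (circle_val w) => [a b] [c d] [e f] /=.
move=> yu yv yw cvu cwu cvw.
have h1 : (c * b - d * a) * f < 0 by rewrite pmulr_rlt0.
have h2 : 0 <= (e * b - f * a) * d by rewrite mulr_le0 // ltW.
have h3 := mulr_ge0 (ltW cvw) yu.
lra.
Qed.

(** A closed curve that bounds a triangle without the origin crosses the ray
    zero times in all. *)
Lemma crossing_cocycle (R : realType) (u v w : circle R) :
  chord_close u v -> chord_close v w -> chord_close u w ->
  crossing u v + crossing v w = crossing u w.
Proof.
have flip a b c : crossing a b + crossing b c + crossing c a = 0 ->
  crossing a b + crossing b c = crossing a c :> int.
  by move/eqP; rewrite (crossing_sym a c) subr_eq0 => /eqP.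
(* Only the edges at the vertex alone on its side of the axis can cross it. *)
have lone a b c : chord_close a b -> chord_close b c -> chord_close a c ->
    ((circle_val a).2 < 0) != ((circle_val b).2 < 0) ->
    ((circle_val b).2 < 0) = ((circle_val c).2 < 0) ->
    crossing a b + crossing b c + crossing c a = 0 :> int.
  move=> ab bc ac hab hbc; rewrite (crossing_same_side hbc) addr0.
  apply/eqP; rewrite (crossing_sym a c) subr_eq0; apply/eqP.
  have ba := chord_close_sym ab; have cb := chord_close_sym bc.
  have ca := chord_close_sym ac.
  move: hab hbc; rewrite /crossing /upcrosses.
  have [ya|ya] := ltP (circle_val a).2 0;
    have [yb|yb] := ltP (circle_val b).2 0;
    have [yc|yc] //= := ltP (circle_val c).2 0 => _ _.
    by rewrite !subr0; congr Posz; congr nat_of_bool; apply/idP/idP;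
      apply: cross_gt0_same_above.
  by rewrite !sub0r; congr (- Posz (nat_of_bool _)); apply/idP/idP;
    apply: cross_gt0_same_below.
move=> uv vw uw; apply: flip.
have vu := chord_close_sym uv; have wv := chord_close_sym vw.
have wu := chord_close_sym uw.
have [hvw|hvw] := eqVneq ((circle_val v).2 < 0) ((circle_val w).2 < 0).
  have [huv|huv] := eqVneq ((circle_val u).2 < 0) ((circle_val v).2 < 0).
    by rewrite !crossing_same_side // -hvw -huv.
  exact: lone.
have [huw|huw] := eqVneq ((circle_val u).2 < 0) ((circle_val w).2 < 0).
  by rewrite -addrA addrC; apply: lone.
have huv : ((circle_val u).2 < 0) = ((circle_val v).2 < 0).
  by move: hvw huw; do 3 case: (_ < 0).
by rewrite addrC addrA; apply: lone => //; rewrite eq_sym.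
Qed.

(** * Winding of paths under a coarsely continuous map *)

Lemma compact_unif_mdist (R : realType) (T : pseudoMetricType R)
    (X : metricType R) (K : set T) (f : T -> X) (e : R) :
  compact K -> {within K, continuous f} -> 0 < e ->
  exists2 d, 0 < d &
    forall p q, K p -> K q -> ball p d q -> mdist (f p) (f q) < e.
Proof.
move=> /compact_near_coveringP/near_covering_withinP cK.
move=> /subspace_continuousP cf e0.
pose P (d : R) (p : T) :=
  forall q, K q -> ball p d q -> mdist (f p) (f q) < e.
have : \forall d \near 0^'+, K `<=` P d.
  apply: cK => x Kx.
  have e20 : 0 < e / 2 by rewrite divr_gt0.
  have [r /= r0 xr] : exists2 r, 0 < r &
      forall y, ball x r y -> K y -> mdist (f x) (f y) < e / 2.
    have := cf x Kx (ball (f x) (e / 2)) (nbhsx_ballx _ _ e20).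
    rewrite /= /within /= /nbhs_simpl -nbhs_ballE => -[r r0 xr]; exists r => //.
    by move=> y xy Ky; have := xr y xy Ky; rewrite ballEmdist.
  have r20 : 0 < r / 2 by rewrite divr_gt0.
  exists (ball x (r / 2), [set d | d < r / 2]).
    split; first exact: nbhsx_ballx.
    exact: nbhs_right_lt.
  move=> [p d] /= [xp dr] Kp q Kq pq.
  have fp : mdist (f x) (f p) < e / 2.
    by apply: xr => //; apply: le_ball xp; lra.
  have fq : mdist (f x) (f q) < e / 2.
    apply: xr => //; rewrite [r]splitr; apply: ball_triangle xp _.
    by apply: le_ball pq; exact: ltW.
  rewrite (le_lt_trans (metric_triangle _ (f x) _)) // metric_sym [ltRHS]splitr.
  exact: ltrD.
move=> dK.
have : \forall d \near 0^'+, 0 < d /\ K `<=` P d.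
  by apply: filterI => //; exact: nbhs_right_gt.
by move=> /(@filter_ex _ _ _) [d [d0 Pd]]; exists d => // p q Kp; exact: Pd.
Qed.

(** [F] need not be continuous, so the winding of the image of a path is
    witnessed by a lift [L], which plays the role of a continuous choice of
    argument: over short parameter intervals it varies as the crossings do.
    [w] is an integer even for open paths, because only crossings of the ray are
    counted. *)
Definition has_winding (R : realType) (X : metricType R) (F : X -> circle R)
    (x y : X) (w : int) : Prop :=
  exists g : R -> X, exists L : R -> int,
  [/\ is_path x y g, L 1 - L 0 = w &
      exists2 d : R, 0 < d & forall s t : R, s \in `[0, 1] -> t \in `[0, 1] ->
        `|s - t| < d -> L t - L s = crossing (F (g s)) (F (g t))].

Lemma subdivision_in01 (R : realType) (i n : nat) : (0 < n)%N -> (i <= n)%N ->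
  (i%:R / n%:R : R) \in `[0, 1].
Proof.
move=> n0 ni; rewrite in_itv /= divr_ge0 // ler_pdivrMr ?ltr0n //.
by rewrite mul1r ler_nat.
Qed.

Lemma subdivision_step (R : realType) (i n : nat) (d : R) :
  (0 < n)%N -> n%:R^-1 < d -> `|i%:R / n%:R - i.+1%:R / n%:R| < d.
Proof.
move=> n0 nd; rewrite -mulrBl -natr1 opprD addNKr mulN1r normrN.
by rewrite ger0_norm // invr_ge0.
Qed.

(** On a grid fine enough for the homotopy, the crossings along two consecutive
    rows differ by a telescoping sum of crossings along vertical edges, whose
    end terms vanish as the vertical sides of the square are sent to [x].  The
    bottom row computes [L 1 - L 0], and the top row is constant. *)
Lemma null_homotopic_winding (R : realType) (X : metricType R)
    (F : X -> circle R) (eta : R) (x : X) (g : R -> X) (L : R -> int) (d : R) :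
  0 < eta -> (forall p q, mdist p q < eta -> chord_close (F p) (F q)) ->
  path_homotopic x x g (cst x) -> 0 < d ->
  (forall s t : R, s \in `[0, 1] -> t \in `[0, 1] -> `|s - t| < d ->
     L t - L s = crossing (F (g s)) (F (g t))) ->
  L 1 = L 0.
Proof.
move=> eta0 HF [H [cH Hg Hx H0 H1]] d0 HL.
have [e e0 He] : exists2 e : R, 0 < e &
    forall p q : R * R, (`[0, 1] `*` `[0, 1]) p ->
    (`[0, 1] `*` `[0, 1]) q -> ball p e q -> mdist (H p) (H q) < eta.
  by apply: compact_unif_mdist => //; apply: compact_setX;
    exact: segment_compact.
pose n := (Num.truncn (Num.min d e)^-1).+1.
have de0 : 0 < Num.min d e by rewrite lt_min d0.
have nde : n%:R^-1 < Num.min d e.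
  rewrite invf_plt ?posrE ?ltr0n // /n.
  by have /andP[] := truncn_itv (ltW (eqbRL (invr_gt0 _) de0)).
move: nde; rewrite lt_min => /andP[nd ne].
have n0 : (0 < n)%N by [].
pose T (i : nat) : R := i%:R / n%:R.
have T0 : T 0%N = 0 by rewrite /T mul0r.
have T1 : T n = 1 by rewrite /T divff // pnatr_eq0.
have T01 i : (i <= n)%N -> T i \in `[0, 1] by exact: subdivision_in01.
have near i j i' j' : (i <= n)%N -> (j <= n)%N -> (i' <= n)%N -> (j' <= n)%N ->
    `|T i - T i'| < e -> `|T j - T j'| < e ->
    chord_close (F (H (T i, T j))) (F (H (T i', T j'))).
  move=> ? ? ? ? ii jj; apply: HF; apply: He; last by split.
    by split; exact: T01.
  by split; exact: T01.
have step i : `|T i - T i.+1| < e by exact: subdivision_step.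
have step0 i : `|T i - T i| < e by rewrite subrr normr0.
pose c i j i' j' := crossing (F (H (T i, T j))) (F (H (T i', T j'))).
pose S j := \sum_(0 <= i < n) c i j i.+1 j.
have SS j : (j < n)%N -> S j.+1 = S j.
  move=> jn; apply/eqP; rewrite -subr_eq0 -sumrB.
  rewrite (eq_big_nat _ _ (F2 := fun i => c i.+1 j i.+1 j.+1 - c i j i j.+1)).
    rewrite telescope_sumr // /c T0 T1 !H0 ?H1 ?T01 ?(ltnW jn) //.
    by rewrite !crossing_refl subrr.
  move=> i /andP[_ i_n]; rewrite /c.
  have jn' := ltnW jn; have in' := ltnW i_n.
  (* The diagonal cuts the grid cell into two triangles. *)
  have e1 := crossing_cocycle
    (near i j i j.+1 in' jn' in' jn (step0 i) (step j))
    (near i j.+1 i.+1 j.+1 in' jn i_n jn (step i) (step0 _))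
    (near i j i.+1 j.+1 in' jn' i_n jn (step i) (step j)).
  have e2 := crossing_cocycle
    (near i j i.+1 j in' jn' i_n jn' (step i) (step0 j))
    (near i.+1 j i.+1 j.+1 i_n jn' i_n jn (step0 _) (step j))
    (near i j i.+1 j.+1 in' jn' i_n jn (step i) (step j)).
  move: e2; rewrite -e1; lia.
have S0 j : (j <= n)%N -> S j = S 0%N.
  by elim: j => // j ih jn; rewrite SS // ih // ltnW.
have Sn : S n = 0.
  rewrite /S big_nat big1 // => i /andP[_ i_n]; rewrite /c T1.
  by rewrite !Hx ?T01 ?(ltnW i_n) // crossing_refl.
have SL : S 0%N = L 1 - L 0.
  rewrite -T1 -[in RHS]T0 -(telescope_sumr (L \o T) (leq0n n)) /S.
  apply: eq_big_nat => i /andP[_ i_n] /=.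
  rewrite /c T0 !Hg ?T01 ?(ltnW i_n) // HL ?T01 ?(ltnW i_n) //.
  exact: subdivision_step.
by apply/eqP; rewrite -subr_eq0 -SL -(S0 n) // Sn.
Qed.

Lemma has_winding_refl (R : realType) (X : metricType R)
    (F : X -> circle R) (x : X) : has_winding F x x 0.
Proof.
exists (cst x), (cst 0); split => //.
  by split => //; apply: continuous_subspaceT => z; exact: cvg_cst.
by exists 1 => // s t _ _ _; rewrite /= crossing_refl.
Qed.

Lemma within_continuous_comp (T U V : topologicalType) (A : set T) (B : set U)
    (f : T -> U) (g : U -> V) :
  continuous f -> (forall t, A t -> B (f t)) ->
  {within B, continuous g} -> {within A, continuous (g \o f)}.
Proof.
move=> cf AB /subspace_continuousP cg; apply/subspace_continuousP => t At.
apply: cvg_comp (cg _ (AB t At)) => W BW.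
have := cf t _ BW; rewrite /= nbhs_simpl /within /=.
by apply: filterS => z + Az; apply; exact: AB.
Qed.

Lemma is_path_cat (R : realType) (X : topologicalType) (x y z : X)
    (g h : R -> X) :
  is_path x y g -> is_path y z h ->
  is_path x z (fun t => if t <= 2^-1 then g (2 * t) else h (2 * t - 1)).
Proof.
move=> [cg g0 g1] [ch h0 h1]; split; last 2 first.
- by rewrite mulr0 invr_ge0 ler0n.
- by rewrite ifF; [rewrite -h1; congr h; lra|apply/negbTE; rewrite -ltNge; lra].
have -> : `[0, 1]%classic = `[0, 2^-1]%classic `|` `[(2^-1 : R), 1]%classic.
  apply/seteqP; split=> t /=; rewrite !in_itv /=.
    by move=> /andP[t0 t1]; have [tl|tr] := leP t 2^-1; [left|right];
      rewrite ?t0 ?t1 ?(ltW tr).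
  by case=> /andP[a b]; apply/andP; split; lra.
have cgl : {within `[0, 2^-1], continuous (g \o (fun t : R => 2 * t))}.
  refine (@within_continuous_comp R R X _ _ _ _ _ _ cg).
    by move=> t; apply: cvgM; [exact: cvg_cst|exact: cvg_id].
  by move=> t /=; rewrite !in_itv /= => /andP[a b]; apply/andP; split; lra.
have chr : {within `[2^-1, 1], continuous (h \o (fun t : R => 2 * t - 1))}.
  refine (@within_continuous_comp R R X _ _ _ _ _ _ ch).
    move=> t; apply: cvgB; last exact: cvg_cst.
    by apply: cvgM; [exact: cvg_cst|exact: cvg_id].
  by move=> t /=; rewrite !in_itv /= => /andP[a b]; apply/andP; split; lra.
apply: withinU_continuous; try exact: itv_closed.
  apply: subspace_eq_continuous cgl => t; rewrite inE /= in_itv /=.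
  by rewrite /from_subspace => /andP[_ t1]; rewrite ifT.
apply: subspace_eq_continuous chr => t; rewrite inE /= in_itv /=.
rewrite /from_subspace => /andP[t0 _]; case: ifPn => // t1.
have -> : t = 2^-1 by apply/eqP; rewrite eq_le t0 t1.
by rewrite /= mulfV // subrr g1 h0.
Qed.

Lemma path_unif_mdist (R : realType) (X : metricType R) (x y : X) (g : R -> X)
    (e : R) :
  is_path x y g -> 0 < e ->
  exists2 d : R, 0 < d & forall s t : R, s \in `[0, 1] -> t \in `[0, 1] ->
    `|s - t| < d -> mdist (g s) (g t) < e.
Proof.
move=> [cg _ _] e0.
have [d d0 dg] := compact_unif_mdist (segment_compact (a := 0) (b := 1)) cg e0.
by exists d.
Qed.

(** The lifts are glued after shifting the second one.  A short interval that
    straddles the junction is cut there, and the cocycle relation adds up the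
    two pieces. *)
Lemma has_winding_cat (R : realType) (X : metricType R) (F : X -> circle R)
    (eta : R) (x y z : X) (w w' : int) :
  0 < eta -> (forall p q, mdist p q < eta -> chord_close (F p) (F q)) ->
  has_winding F x y w -> has_winding F y z w' -> has_winding F x z (w + w').
Proof.
move=> eta0 HF [g [L [pg Lw [d d0 Ld]]]] [h [M [ph Mw [e e0 Me]]]].
have pk := is_path_cat pg ph.
set k := (fun t => if _ then _ else _) in pk.
pose N (t : R) := if t <= 2^-1 then L (2 * t) else M (2 * t - 1) - M 0 + L 1.
have right_half t : 2^-1 <= t ->
    k t = h (2 * t - 1) /\ N t = M (2 * t - 1) - M 0 + L 1.
  rewrite /k /N => t0; case: ifPn => // t1.
  have -> : t = 2^-1 by apply/eqP; rewrite eq_le t0 t1.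
  rewrite mulfV // subrr; case: pg ph => [_ _ ->] [_ -> _].
  by split => //; rewrite subrr add0r.
have [r r0 rk] := path_unif_mdist pk eta0.
exists k, N; split => //.
  have [_ ->] : k 1 = h (2 * 1 - 1) /\ N 1 = M (2 * 1 - 1) - M 0 + L 1.
    by apply: right_half; lra.
  have -> : 2 * 1 - 1 = 1 :> R by lra.
  by rewrite /N ifT ?invr_ge0 // mulr0 -Lw -Mw -addrA addrC.
pose good s t := N t - N s = crossing (F (k s)) (F (k t)).
exists (Num.min r (Num.min (d / 2) (e / 2))).
  by rewrite !lt_min r0 !divr_gt0.
pose near (s t : R) := `|s - t| < Num.min r (Num.min (d / 2) (e / 2)).
have scale (s t : R) (c : R) : `|s - t| < c / 2 -> `|2 * s - 2 * t| < c.
  by move=> st; rewrite -mulrBr normrM [`|2|]ger0_norm //; lra.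
have half0 : 0 <= 2^-1 :> R by rewrite invr_ge0.
have half1 : 2^-1 <= 1 :> R by lra.
have half01 : 0 <= (2^-1 : R) <= 1 by rewrite half0 half1.
have left_good (s t : R) : 0 <= s <= 2^-1 -> 0 <= t <= 2^-1 -> near s t ->
    good s t.
  move=> /andP[s0 s1] /andP[t0 t1]; rewrite /near !lt_min.
  move=> /and3P[_ /scale st _].
  by rewrite /good /N /k s1 t1; apply: Ld => //;
    rewrite in_itv /=; apply/andP; split; lra.
have right_good (s t : R) : 2^-1 <= s <= 1 -> 2^-1 <= t <= 1 -> near s t ->
    good s t.
  move=> /andP[s0 s1] /andP[t0 t1]; rewrite /near !lt_min.
  move=> /and3P[_ _ /scale st].
  have [ks Ns] := right_half s s0; have [kt Nt] := right_half t t0.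
  rewrite /good ks kt Ns Nt -Me; first by ring.
  - by rewrite in_itv /=; apply/andP; split; lra.
  - by rewrite in_itv /=; apply/andP; split; lra.
  - by have -> : 2 * s - 1 - (2 * t - 1) = 2 * s - 2 * t by lra.
have good_sym s t : good s t -> good t s.
  by rewrite /good (crossing_sym (F (k s))) => <-; rewrite opprB.
have across (s t : R) : 0 <= s <= 2^-1 -> 2^-1 <= t <= 1 -> near s t ->
    good s t.
  move=> s01 t01 st; have /andP[s0 s1] := s01; have /andP[t0 t1] := t01.
  have sm : near s 2^-1.
    by apply: le_lt_trans st; rewrite !ler0_norm; lra.
  have mt : near 2^-1 t.
    by apply: le_lt_trans st; rewrite !ler0_norm; lra.
  have close_k a b : 0 <= a <= 1 -> 0 <= b <= 1 -> near a b ->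
      chord_close (F (k a)) (F (k b)).
    rewrite /near lt_min => a01 b01 /andP[ab _]; apply: HF.
    by apply: rk => //; rewrite in_itv.
  have s1' : 0 <= s <= 1 by rewrite s0 (le_trans s1).
  have t0' : 0 <= t <= 1 by rewrite t1 (le_trans _ t0).
  rewrite /good -(crossing_cocycle (close_k s 2^-1 s1' half01 sm)
    (close_k 2^-1 t half01 t0' mt) (close_k s t s1' t0' st)).
  have <- : good s 2^-1 by apply: left_good; rewrite // lexx half0.
  have <- : good 2^-1 t by apply: right_good; rewrite // lexx half1.
  by rewrite [RHS]addrC subrKA.
move=> s t; rewrite !in_itv /= => /andP[s0 s1] /andP[t0 t1] st.
have ts : near t s by rewrite /near distrC.
have [sm|sm] := leP s 2^-1; have [tm|tm] := leP t 2^-1.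
- by apply: left_good; rewrite // ?s0 ?t0 ?sm ?tm.
- by apply: across; rewrite // ?s0 ?t1 ?sm ?(ltW tm).
- by apply: good_sym; apply: across; rewrite // ?t0 ?s1 ?tm ?(ltW sm).
- by apply: right_good; rewrite // ?s1 ?t1 ?(ltW sm) ?(ltW tm).
Qed.

(** Near [x] the crossings are counted from [u], near [y] from [v]; the
    margin [eta] makes both counts valid, and equal, at consecutive points
    that are attached to different ends. *)
Lemma has_winding_link (R : realType) (X : metricType R) (F : X -> circle R)
    (rho eta : R) (u v : circle R) (x y : X) (g : R -> X) :
  0 < rho -> 0 < eta ->
  (forall p q, mdist p q < eta -> chord_close (F p) (F q)) ->
  chord_close u v ->
  (forall p, mdist x p < rho + eta -> chord_close u (F p)) ->
  (forall p, mdist y p < rho + eta -> chord_close v (F p)) ->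
  is_path x y g ->
  (forall t, t \in `[0, 1] -> mdist x (g t) < rho \/ mdist y (g t) < rho) ->
  has_winding F x y (crossing u v + crossing v (F y) - crossing u (F x)).
Proof.
move=> rho0 eta0 HF uv ux vy pg gt.
pose L t := if mdist x (g t) < rho then crossing u (F (g t))
            else crossing u v + crossing v (F (g t)).
have Lx t : t \in `[0, 1] -> mdist x (g t) < rho + eta ->
    L t = crossing u (F (g t)).
  move=> t01 xt; rewrite /L; case: ifPn => // ntx.
  apply: crossing_cocycle => //; last exact: ux.
  apply: vy; case: (gt t t01) => [xt'|yt]; first by rewrite xt' in ntx.
  by rewrite (lt_trans yt) // ltrDl.
have Ly t : ~~ (mdist x (g t) < rho) ->
    L t = crossing u v + crossing v (F (g t)).
  by rewrite /L => /negbTE ->.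
have [d d0 dg] := path_unif_mdist pg eta0.
exists g, L; split => //.
  case: pg => _ g0 g1; rewrite /L g0 g1 mdistxx rho0; case: ifPn => // xy.
  rewrite (crossing_cocycle uv) //; first by apply: vy; rewrite mdistxx addr_gt0.
  by apply: ux; rewrite (lt_trans xy) // ltrDl.
have fromx s t : s \in `[0, 1] -> t \in `[0, 1] -> `|s - t| < d ->
    mdist x (g s) < rho -> L t - L s = crossing (F (g s)) (F (g t)).
  move=> s01 t01 st xs; have gst := dg _ _ s01 t01 st.
  have xs' : mdist x (g s) < rho + eta by rewrite (lt_trans xs) // ltrDl.
  have xt : mdist x (g t) < rho + eta.
    by rewrite (le_lt_trans (metric_triangle _ (g s) _)) // ltrD.
  rewrite !Lx // -(crossing_cocycle (ux _ xs') (HF _ _ gst) (ux _ xt)).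
  by rewrite addrC addKr.
exists d => // s t s01 t01 st; have ts : `|t - s| < d by rewrite distrC.
have [xs|xs] := boolP (mdist x (g s) < rho); first exact: fromx.
have [xt|xt] := boolP (mdist x (g t) < rho).
  by rewrite (crossing_sym (F (g t))) -fromx // opprB.
have far p : p \in `[0, 1] -> ~~ (mdist x (g p) < rho) ->
    chord_close v (F (g p)).
  move=> p01 xp; apply: vy; case: (gt p p01) => [xp'|yp].
    by rewrite xp' in xp.
  by rewrite (lt_trans yp) // ltrDl.
rewrite !Ly // -(crossing_cocycle (far s s01 xs)
  (HF _ _ (dg _ _ s01 t01 st)) (far t t01 xt)).
lia.
Qed.

(** Testing the length on the subdivision [0 < t < 1] bounds the sum of the
    distances to the two ends. *)
Lemma short_path (R : realType) (X : metricType R) (x y : X) (c : R) :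
  length_space X -> mdist x y < c ->
  exists2 g, is_path x y g &
    forall t : R, t \in `[0, 1] -> mdist x (g t) + mdist (g t) y < c.
Proof.
move=> lX xyc; have : ((mdist x y)%:E < c%:E)%E by rewrite lte_fin.
rewrite (lX x y) => /ereal_inf_lt[_ [g pg <-] gc]; exists g => // t.
have [_ g0 g1] := pg.
rewrite in_itv /= => /andP[t0 t1].
move: t0; rewrite le_eqVlt => /predU1P[<-|t0]; first by rewrite g0 mdistxx add0r.
move: t1; rewrite le_eqVlt => /predU1P[->|t1].
  by rewrite g1 mdistxx addr0.
rewrite -lte_fin; apply: le_lt_trans gc; apply: ereal_sup_ubound.
exists [:: t; 1] => /=; first by split; rewrite /= ?t0 ?t1.
by rewrite !big_nat_recl // big_geq //= g0 g1 addr0.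
Qed.

(** * Regular polygons inscribed in the circle *)

Lemma circle_point_subproof (R : realType) (a : R) :
  euclid_norm (cos a, sin a) == 1.
Proof. by rewrite /euclid_norm /= cos2Dsin2 sqrtr1. Qed.

Definition circle_point (R : realType) (a : R) : circle R :=
  Circle (circle_point_subproof a).

(** The regular polygon has [2 n] vertices, so that the vertices of rank [0] and
    [n] lie on the axis and separate the upper half from the lower one. *)
Definition polygon (R : realType) (n k : nat) : circle R :=
  circle_point (k%:R * (pi / n%:R)).

Lemma polygon_edge_dist (R : realType) (n k : nat) :
  mdist (polygon R n k) (polygon R n k.+1) ^+ 2 = 2 - 2 * cos (pi / n%:R).
Proof.
rewrite circle_dist_sqr /dot /= -cosB -cosN opprB; congr (_ - 2 * cos _).
by rewrite -mulrBl -natr1 addrC addKr mul1r.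
Qed.

Lemma fine_polygon (R : realType) (e : R) : 0 < e ->
  exists2 n, (1 < n)%N & forall k, mdist (polygon R n k) (polygon R n k.+1) < e.
Proof.
move=> e0; have e2 : 0 < e ^+ 2 / 2 by rewrite divr_gt0 // exprn_gt0.
have c0 : (fun n : nat => pi / n.+1%:R : R) @ \oo --> (0 : R).
  have h : (fun n : nat => (pi : R) * harmonic n) @ \oo --> (pi : R) * 0.
    by apply: cvgM; [exact: cvg_cst|exact: cvg_harmonic].
  by rewrite mulr0 in h; exact: h.
have cpi : (fun n : nat => cos (pi / n.+1%:R : R)) @ \oo --> cos (0 : R).
  exact: cvg_comp c0 (@continuous_cos R 0).
have /cvgrPdist_lt /(_ _ e2) [N _ /(_ N.+1 (leqnSn N)) /=] := cpi.
rewrite cos0 => cN; exists N.+2 => // k.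
rewrite -(ltr_pXn2r (n := 2)) ?nnegrE ?mdist_ge0 ?(ltW e0) //.
rewrite polygon_edge_dist.
have := ler_norm (1 - cos (pi / N.+2%:R : R)); lra.
Qed.

Lemma polygon_closed (R : realType) (n : nat) : (0 < n)%N ->
  polygon R n n.*2 = polygon R n 0.
Proof.
move=> n0; apply: val_inj => /=.
have -> : n.*2%:R * (pi / n%:R) = pi *+ 2 :> R.
  rewrite -muln2 natrM mulrAC mulrCA divff ?pnatr_eq0 -?lt0n //.
  by rewrite mulr1 mulr_natr.
by rewrite mul0r cos2pi sin2pi cos0 sin0.
Qed.

Lemma polygon_above (R : realType) (n k : nat) : (0 < n)%N -> (k <= n)%N ->
  ((circle_val (polygon R n k)).2 < 0) = false.
Proof.
move=> n0 kn; apply/negbTE; rewrite -leNgt /=; apply: sin_ge0_pi.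
rewrite mulr_ge0 ?divr_ge0 ?pi_ge0 //=.
by rewrite mulrCA ger_pMr ?pi_gt0 // ler_pdivrMr ?ltr0n // mul1r ler_nat.
Qed.

Lemma polygon_below (R : realType) (n k : nat) : (n < k < n.*2)%N ->
  (circle_val (polygon R n k)).2 < 0.
Proof.
move=> /andP[nk kn]; have n0 : (0 < n)%N by lia.
rewrite /=.
have -> : k%:R * (pi / n%:R) = (k - n)%:R * (pi / n%:R) + pi :> R.
  rewrite natrB ?(ltnW nk) // mulrBl [n%:R * _]mulrCA divff ?mulr1 ?subrK //.
  by rewrite pnatr_eq0 -lt0n.
rewrite sinDpi oppr_lt0; apply: sin_gt0_pi.
rewrite mulr_gt0 ?divr_gt0 ?pi_gt0 ?ltr0n ?subn_gt0 //=.
rewrite mulrCA gtr_pMr ?pi_gt0 // ltr_pdivrMr ?ltr0n // mul1r ltr_nat; lia.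
Qed.

(** Only two edges have their ends on different sides of the axis: the one that
    leaves [(-1, 0)] passes to the left of the origin, and the last one, which
    comes up to [(1, 0)], counts for one.  For [n = 1] the polygon never goes
    below the axis. *)
Lemma polygon_crossings (R : realType) (n : nat) : (1 < n)%N ->
  \sum_(0 <= k < n.*2) crossing (polygon R n k) (polygon R n k.+1) = 1.
Proof.
move=> n1; have n0 : (0 < n)%N by lia.
have e2 : n.*2 = n.*2.-1.+1 by lia.
rewrite e2 big_nat_recr //= -e2 big_nat big1 => [|k /andP[_ kn]].
  have := @polygon_below R n n.*2.-1; rewrite polygon_closed //.
  rewrite /crossing /upcrosses /cross /= mul0r cos0 sin0 => y0.
  by rewrite y0 ?lexx ?ltxx /= ?mulr0 ?mulr1 ?sub0r ?oppr_gt0 ?y0 //=; lia.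
have [kn'|nk] := ltnP k n.
  by rewrite crossing_same_side // !polygon_above // ltnW.
move: nk; rewrite leq_eqVlt => /predU1P[<-|nk].
  have := @polygon_below R n n.+1.
  have -> : polygon R n n = circle_point pi.
    by congr circle_point; rewrite mulrCA divff ?mulr1 // pnatr_eq0 -lt0n.
  rewrite /crossing /upcrosses /cross /= cospi sinpi => y0.
  have {}y0 := y0 ltac:(lia).
  by rewrite leNgt y0 /= lexx andbF /= mulr0 mulrN1 opprK !add0r ltNge (ltW y0).
by rewrite crossing_same_side // !polygon_below //; lia.
Qed.

(** * The distance from a simply connected length space to the circle *)

(** The three estimates hold when [F] and [G] pick points at distance less than
    [r], between isometric copies of [X] and of the circle in a common space.
    If [3 r < sqrt 3], short paths between the points [G (c k)], where the [c k]
    form a fine polygon, make up a null-homotopic loop of winding number one. *)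
Lemma rough_inverse_bound (R : realType) (X : metricType R) (r : R)
    (F : X -> circle R) (G : circle R -> X) :
  simply_connected R X -> length_space X ->
  (forall x x', mdist (F x) (F x') <= mdist x x' + 2 * r) ->
  (forall u v, mdist (G u) (G v) <= mdist u v + 2 * r) ->
  (forall u x, mdist u (F x) <= mdist (G u) x + 2 * r) ->
  Num.sqrt 3 <= 3 * r.
Proof.
move=> [_ null] lX HF HG HFG; rewrite leNgt; apply/negP => r3.
have r0 : 0 <= r.
  by have := HG (circle_point 0) (circle_point 0); rewrite !mdistxx; lra.
pose eta := (Num.sqrt 3 - 3 * r) / 3.
have eta0 : 0 < eta by rewrite /eta; lra.
(* A point within [r + eta] of [G u] or next to one is sent at distance at most
   [(r + 2 * eta) + 2 * r] from [u]. *)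
have slack : 3 * r + 2 * eta < Num.sqrt 3 by rewrite /eta; lra.
pose rho := r + eta.
have rho0 : 0 < rho by rewrite /rho; lra.
have Fclose p q : mdist p q < eta -> chord_close (F p) (F q).
  by rewrite /chord_close; have := HF p q; lra.
have FGclose u p : mdist (G u) p < rho + eta -> chord_close u (F p).
  by rewrite /chord_close /rho; have := HFG u p; lra.
have eta20 : 0 < 2 * eta by lra.
have [n n1 edge] := fine_polygon eta20.
pose c := polygon R n.
(* [F (G (c k))] need not be [c k]; the discrepancy telescopes. *)
pose defect k := crossing (c k) (F (G (c k))).
have link k : has_winding F (G (c k)) (G (c k.+1))
    (crossing (c k) (c k.+1) + defect k.+1 - defect k).
  have ck := edge k; rewrite -/c in ck.
  have Gk : mdist (G (c k)) (G (c k.+1)) < 2 * rho.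
    by rewrite /rho; have := HG (c k) (c k.+1); lra.
  have [g pg gshort] := short_path lX Gk.
  apply: (has_winding_link rho0 eta0 Fclose _ _ _ pg).
  - by rewrite /chord_close; lra.
  - by move=> p; exact: FGclose.
  - by move=> p; exact: FGclose.
  move=> t t01; have := gshort t t01; rewrite (metric_sym (g t)) => short.
  have [|tx] := ltP (mdist (G (c k)) (g t)) rho; first by left.
  by right; lra.
have chain k : has_winding F (G (c 0%N)) (G (c k))
    (\sum_(0 <= i < k) crossing (c i) (c i.+1) + defect k - defect 0%N).
  elim: k => [|k IHk].
    by rewrite big_geq // add0r subrr; exact: has_winding_refl.
  have := has_winding_cat eta0 Fclose IHk (link k).
  rewrite big_nat_recr //=; congr has_winding; ring.
have := chain n.*2; rewrite polygon_crossings // /defect /c.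
rewrite polygon_closed ?(ltnW n1) // addrK => -[g [L [pg Lw [d d0 Ld]]]].
have := null_homotopic_winding eta0 Fclose (null _ _ pg) d0 Ld.
by move=> LL; move: Lw; rewrite LL subrr.
Qed.

Lemma hausdorff_dist_lt (R : realType) (Z : metricType R) (A B : set Z)
    (r : R) :
  (hausdorff_dist A B < r%:E)%E ->
  (forall a, A a -> exists2 b, B b & mdist a b < r) /\
  (forall b, B b -> exists2 a, A a & mdist b a < r).
Proof.
rewrite /hausdorff_dist gt_max => /andP[AB BA].
have near (C D : set Z) : (ereal_sup [set dist_to_set c D | c in C] < r%:E)%E ->
    forall c, C c -> exists2 d, D d & mdist c d < r.
  move=> CD c Cc.
  have : (dist_to_set c D < r%:E)%E.
    by apply: le_lt_trans CD; apply: ereal_sup_ubound; exists c.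
  by move=> /ereal_inf_lt[_ [d Dd <-]]; rewrite lte_fin => cd; exists d.
by split; exact: near.
Qed.

Lemma gromov_hausdorff_circle_ge (R : realType) (X : metricType R) (r : R) :
  simply_connected R X -> length_space X -> 3 * r < Num.sqrt 3 ->
  (r%:E <= gromov_hausdorff_dist X (circle R))%E.
Proof.
move=> scX lX r3; rewrite leNgt; apply/negP => /ereal_inf_lt[].
move=> _ [Z [A [B [[f fiso fA] [g giso gB] ->]]]] /hausdorff_dist_lt[AB BA].
suff : Num.sqrt 3 <= 3 * r by rewrite leNgt r3.
have nearF x : exists u, mdist (f x) (g u) < r.
  have /AB[z] : A (f x) by rewrite -fA; exists x.
  by rewrite -gB => -[u _ <-] ?; exists u.
have nearG u : exists x, mdist (g u) (f x) < r.
  have /BA[z] : B (g u) by rewrite -gB; exists u.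
  by rewrite -fA => -[x _ <-] ?; exists x.
have [F HF] := choice nearF; have [G HG] := choice nearG.
apply: (@rough_inverse_bound R X r F G scX lX).
- move=> x x'; rewrite -giso -fiso.
  have := metric_triangle (g (F x)) (f x) (g (F x')).
  have := metric_triangle (f x) (f x') (g (F x')).
  by rewrite (metric_sym (g (F x)) (f x)); have := HF x; have := HF x'; lra.
- move=> u v; rewrite -giso -fiso.
  have := metric_triangle (f (G u)) (g u) (f (G v)).
  have := metric_triangle (g u) (g v) (f (G v)).
  by rewrite (metric_sym (f (G u)) (g u)); have := HG u; have := HG v; lra.
- move=> u x; rewrite -giso -fiso.
  have := metric_triangle (g u) (f (G u)) (g (F x)).
  have := metric_triangle (f (G u)) (f x) (g (F x)).
  by have := HG u; have := HF x; lra.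
Qed.

(** With [s = sqrt (1 - d^2)], this is [2 - 2 s - d^2 = (1 - s)^2 >= 0]. *)
Lemma le_chord_of_sine (R : realType) (d : R) : 0 <= d -> d <= 1 ->
  d <= Num.sqrt (2 - 2 * Num.sqrt (1 - d ^+ 2)).
Proof.
move=> d0 d1; have s2 : Num.sqrt (1 - d ^+ 2) ^+ 2 = 1 - d ^+ 2.
  by rewrite sqr_sqrtr // subr_ge0 expr_le1.
rewrite -[leLHS](ger0_norm d0) -sqrtr_sqr ler_wsqrtr //.
have := sqr_ge0 (Num.sqrt (1 - d ^+ 2) - 1); rewrite sqrrB1 s2 mulr2n; lra.
Qed.

Unset Implicit Arguments.

(* [D <= 1] makes [D] a real number, so [fine] is not junk here. *)
Theorem mainTheorem5 (R : realType) (X : metricType R)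
    (X_nonempty : inhabited X)
    (X_simply_connected : simply_connected R X)
    (X_length : length_space X) :
  let D := gromov_hausdorff_dist X (circle R) in
  ~ ((D <= 1)%E /\
     fine D + Num.sqrt (2 - 2 * Num.sqrt (1 - fine D ^+ 2)) < 1).
Proof.
move=> D [D1 Dlt1].
have Dhalf : (D < (2^-1)%:E)%E.
  move: D1 Dlt1; case: D => [d| |] //=; rewrite ?lee_fin ?lte_fin ?ltNyr //.
  move=> d1; have [d0|] := leP 0 d; last lra.
  have := le_chord_of_sine d0 d1; lra.
suff r3 : 3 * 2^-1 < Num.sqrt 3 :> R.
  have := gromov_hausdorff_circle_ge X_simply_connected X_length r3.
  by rewrite leNgt Dhalf.
rewrite -(ltr_pXn2r (n := 2)) ?nnegrE ?sqrtr_ge0 // ?mulr_ge0 ?invr_ge0 //.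
rewrite sqr_sqrtr //; lra.
Qed.
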